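(* Let $F/K$ be a finite Galois, totally and wildly ramified extension of complete discrete valuation fields with residue characteristic $p>0$, all of whose lower ramification jumps $b_1<\dots<b_h$ are prime to $p$. Let $K=F_1\subsetneq F_2\subsetneq\dots\subsetneq F_{h+1}=F$ be the associated tower, and for each $i=1,\dots,h$ let $f_i\in F_{i+1}$ be an element with $v_{i+1}(f_i)=-b_i$ (all notation as in the context). Then $F/K$ has the Hasse–Arf property if and only if for every $i$ with $1<i\le h$ the equality obtained by evaluating at $f_i$ the minimal polynomial $m_i(X)$ of $f_i$ over $F_i$, namely $$m_i(f_i)-m_i(0)=-m_i(0),$$ has the form $$f_i^{[F_{i+1}:F_i]}+\ast=\kappa_i f_{i-1}+\ast$$ for some $\kappa_i\in K\setminus\{0\}$. Here the left side is $m_i(f_i)-m_i(0)$, written as $f_i^{[F_{i+1}:F_i]}$ plus terms of strictly greater $v_{i+1}$-valuation than $f_i^{[F_{i+1}:F_i]}$; the right side is $-m_i(0)$, written as $\kappa_i f_{i-1}$ plus terms of strictly greater $v_{i+1}$-valuation than $\kappa_i f_{i-1}$. (Therefore $[F_{i+1}:F_i]\,v_{i+1}(f_i)=v_{i+1}(\kappa_i f_{i-1})$.)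
   Context: $K$ is a complete discrete valuation field whose residue field has characteristic $p>0$ ($K$ may have characteristic $0$ or $p$), and $F/K$ is a finite Galois extension with group $G$ that is totally ramified ($[F:K]$ equals the ramification index) and wildly ramified in the sense that there is no tame part. Let $v_F$ be the normalized valuation and $\pi_F$ a uniformizer of $F$. The lower ramification groups are $G_j=\{\sigma\in G: v_F(\sigma(\pi_F)-\pi_F)\ge j+1\}$ for $j\ge -1$, and no tame part means $G=G_0=G_1\neq\{1\}$. An integer $j$ is a (lower) ramification jump if $G_j\supsetneq G_{j+1}$; the jumps are $1\le b_1<\dots<b_h$, so $G=G_{b_1}\supsetneq G_{b_2}\supsetneq\dots\supsetneq G_{b_h}\supsetneq G_{b_{h+1}}:=\{1\}$, with $G_{b_i}/G_{b_{i+1}}\simeq(\mathbb{Z}/p\mathbb{Z})^{n_i}$, $n_i\ge1$. Put $F_i=F^{G_{b_i}}$ for $1\le i\le h+1$, so $F_1=K$, $F_{h+1}=F$ and $[F_{i+1}:F_i]=p^{n_i}$. Let $v_i$ be the normalized valuation of $F_i$. Let $\phi(u)=\int_0^u\frac{dt}{[G_0:G_t]}$ for $u\ge0$ and $\phi(u)=u$ for $u\in[-1,0]$, where $G_t:=G_{\lceil t\rceil}$ for real $t$; the upper numbering is $G^{\phi(u)}:=G_u$. The extension $F/K$ has the Hasse–Arf property if its ramification jumps in upper numbering are integers, i.e. $\phi(b_i)\in\mathbb{Z}$ for all $i=1,\dots,h$. *)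

(* Defs.v *)
From HB Require Import structures.
From mathcomp Require Import all_boot all_order all_algebra all_fingroup all_field.
From mathcomp Require Import classical_sets reals constructive_ereal.
From mathcomp Require Import measure lebesgue_measure lebesgue_integral.

Set Implicit Arguments.
Unset Strict Implicit.
Unset Printing Implicit Defensive.

Import Order.TTheory GRing.Theory Num.Theory.

Local Open Scope ring_scope.

(** Valuations take values in [\bar int], with value [+oo] exactly at [0].
    The subfield [E] is a parameter so that the valuations of the intermediate
    fields of an extension [F / K] are all functions on [F], constrained only
    on [E]; for a valuation of [L] itself take [E := predT]. *)
Definition normalized_valuation (L : fieldType) (E : {pred L})
    (v : L -> \bar int) : Prop :=
  [/\ v 0 = +oo%E,
      {in E, forall x, x != 0 -> v x \is a fin_num},
      {in E &, forall x y, v (x * y) = (v x + v y)%E},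
      {in E &, forall x y, (Order.min (v x) (v y) <= v (x + y)%R)%E}
    & forall n : int, exists2 x, x \in E & v x = n%:E].

Definition complete_valuation (L : fieldType) (v : L -> \bar int) : Prop :=
  forall u : nat -> L,
    (forall N : int, exists n0 : nat, forall m n : nat,
        (n0 <= m)%N -> (n0 <= n)%N -> (N%:E <= v (u m - u n)%R)%E) ->
    exists l : L, forall N : int, exists n0 : nat, forall n : nat,
        (n0 <= n)%N -> (N%:E <= v (u n - l)%R)%E.

(** The residue field is the quotient of the valuation ring [0 <= v x] by its
    maximal ideal [0 < v x], so [p%:R] vanishes there iff [0 < v p%:R]. *)
Definition residue_char (L : fieldType) (v : L -> \bar int) (p : nat) : Prop :=
  prime p /\ (0 < v (p%:R)%R)%E.

Section Ramification.

Context (K : fieldType) (F : splittingFieldType K).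

(** [vF] prolongs [vK] with ramification index [e]. *)
Definition ramification_index (vK : K -> \bar int) (vF : F -> \bar int)
    (e : nat) : Prop :=
  (0 < e)%N /\ forall a : K, vF a%:A = (vK a *+ e)%E.

Definition totally_ramified (vK : K -> \bar int) (vF : F -> \bar int) : Prop :=
  ramification_index vK vF (\dim {:F}).

(** [w] is the normalized valuation of the subfield [E] below [vF], i.e. the
    restriction of [vF] to [E] divided by the ramification index of [F / E]. *)
Definition normalized_valuation_below (vF : F -> \bar int) (E : {subfield F})
    (w : F -> \bar int) : Prop :=
  normalized_valuation (mem E) w /\
  exists2 e : nat, (0 < e)%N & {in E, forall x, vF x = (w x *+ e)%E}.

Variables (vF : F -> \bar int) (pi : F).

Definition lower_ram (j : int) : {set gal_of {:F}} :=
  [set s in 'Gal({:F} / 1)%g | ((j + 1)%:E <= vF (s pi - pi)%R)%E]%SET.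

Definition no_tame_part : Prop :=
  [/\ 'Gal({:F} / 1)%g = lower_ram 0 :> {set _},
      lower_ram 0 = lower_ram 1 & lower_ram 1 != [1]%g].

Definition is_lower_jump (j : int) : Prop :=
  -1 <= j /\ (lower_ram (j + 1) \proper lower_ram j).

(** [b 1 < ... < b h] are all the lower jumps; [b] is unconstrained elsewhere. *)
Definition lower_jumps (h : nat) (b : nat -> int) : Prop :=
  (forall i j : nat, (1 <= i)%N -> (i < j)%N -> (j <= h)%N -> b i < b j) /\
  (forall j : int,
     is_lower_jump j <-> exists2 i : nat, (1 <= i <= h)%N & j = b i).

Definition jump_group (h : nat) (b : nat -> int) (i : nat) :
    {set gal_of {:F}} :=
  if (i <= h)%N then lower_ram (b i) else [1]%g.

(** [tower h b i] is [F_i] for [1 <= i <= h + 1]. *)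
Definition tower (h : nat) (b : nat -> int) (i : nat) : {subfield F} :=
  [aspace of fixedField (jump_group h b i)].

(** Only meaningful for [-1 <= u]. *)
Definition herbrand (R : realType) (u : R) : R :=
  if 0 <= u then
    Rintegral (@lebesgue_measure R) [set` `[0, u]]
      (fun t : R => (#|lower_ram 0 : lower_ram (Num.ceil t)|%g%:R)^-1)
  else u.

Definition hasse_arf (R : realType) : Prop :=
  forall j : int, is_lower_jump j -> herbrand (j%:~R : R) \is a Num.int.

End Ramification.

(** [x] is [y] plus terms of strictly greater valuation. *)
Definition plus_higher (L : fieldType) (v : L -> \bar int) (x y : L) : Prop :=
  exists2 z : L, x = y + z & (v y < v z)%E.

(** With [E = F_i], [E' = F_{i+1}], [w = v_{i+1}], [g = f_i], [g' = f_{i-1}]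
    and [m] the minimal polynomial of [g] over [E]: the two sides of the
    equality [m(g) - m(0) = - m(0)] have leading terms [g ^ [E' : E]] and
    [c g'] respectively. *)
Definition leading_form (K : fieldType) (F : splittingFieldType K)
    (w : F -> \bar int) (E E' : {subfield F}) (g g' : F) (c : K) : Prop :=
  let m := minPoly E g in
  [/\ m.[g] - m.[0] = - m.[0],
      plus_higher w (m.[g] - m.[0]) (g ^+ \dim_E E')
    & plus_higher w (- m.[0]) (c *: g')].

(* Main.v *)
Require Import Defs.
From mathcomp Require Import all_boot all_order all_algebra all_fingroup all_field.
From mathcomp Require Import classical_sets reals constructive_ereal.
From mathcomp Require Import measure lebesgue_measure lebesgue_integral.
From mathcomp Require Import pgroup functions set_interval measurable_realfun zify ring.

Set Implicit Arguments.
Unset Strict Implicit.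
Unset Printing Implicit Defensive.

Import Order.TTheory GRing.Theory Num.Theory.

Local Open Scope ring_scope.

(** Every valuation [v_i] is [v_F] divided by [[F : F_i]], so all statements can
    be read off from [v_F] on [F]. Since [v_{i+1}(f_i) = - b_i] is prime to
    [q = [F_{i+1} : F_i]], a power of [p], the terms [c_j f_i^j] with [0 < j < q]
    of [m_i(f_i)] have valuations outside the value group of [F_i]; hence
    [m_i(f_i) - m_i(0)] always has leading term [f_i^q], and [m_i(0)] has
    [v_i]-valuation [- b_i]. As residue fields do not grow, [- m_i(0)] has leading
    term [kappa f_{i-1}] for some [kappa] in [K] iff [- b_i] and [- b_{i-1}] differ
    by an element of [[F_i : K] Z], the value group of [K] under [v_i]. On the
    other hand the Herbrand function is affine between consecutive jumps, which gives
    [phi(b_i) - phi(b_{i-1}) = (b_i - b_{i-1}) / [F_i : K]]; since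
    [phi(b_1) = b_1], the Hasse-Arf property is the same congruence. *)

(** * Valuations *)

Section Valuation.

Variables (L : fieldType) (v : L -> \bar int).
Hypothesis vP : normalized_valuation predT v.

Lemma val0 : v 0 = +oo%E.
Proof. by case: vP. Qed.

Lemma valM x y : v (x * y) = (v x + v y)%E.
Proof. by case: vP => _ _ vM _ _; apply: vM. Qed.

Lemma valD_min x y : (Order.min (v x) (v y) <= v (x + y)%R)%E.
Proof. by case: vP => _ _ _ vD _; apply: vD. Qed.

Lemma val_fin x : x != 0 -> {k : int | v x = k%:E}.
Proof.
by case: vP => _ vfin _ _ _ /(vfin x isT) vx; exists (fine (v x)); rewrite fineK.
Qed.

Lemma val_fin_num x : x != 0 -> v x \is a fin_num.
Proof. by case/val_fin => k ->. Qed.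

Lemma val_neq0 x (k : int) : v x = k%:E -> x != 0.
Proof. by apply: contra_eq_neq => ->; rewrite val0. Qed.

Lemma valD_ge x y (c : \bar int) : (c <= v x -> c <= v y -> c <= v (x + y)%R)%E.
Proof. by move=> cx cy; apply: le_trans (valD_min x y); rewrite le_min cx. Qed.

Lemma valD_gt x y (c : \bar int) : (c < v x -> c < v y -> c < v (x + y)%R)%E.
Proof. by move=> cx cy; apply: lt_le_trans (valD_min x y); rewrite lt_min cx. Qed.

Lemma val1 : v 1 = 0%E.
Proof.
have [k vk] := val_fin (oner_neq0 L); have := valM 1 1.
by rewrite mulr1 vk -EFinD => -[kk]; congr (_%:E); lia.
Qed.

Lemma valN x : v (- x) = v x.
Proof.
suff v1: v (-1) = 0%E by rewrite -mulN1r valM v1 add0e.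
have [|k vk] := @val_fin (-1); first by rewrite oppr_eq0 oner_eq0.
have := valM (-1) (-1).
by rewrite mulrNN mulr1 val1 vk -EFinD => -[kk]; congr (_%:E); lia.
Qed.

Lemma valDl x y : (v x < v y)%E -> v (x + y) = v x.
Proof.
move=> xy; apply/eqP; rewrite eq_le andbC valD_ge ?(ltW xy) //= leNgt.
apply/negP => xxy; suff: (v x < v x)%E by rewrite ltxx.
by rewrite -{2}(addrK y x) valD_gt ?valN.
Qed.

Lemma val_sum_gt (I : finType) (P : pred I) (x : I -> L) (c : \bar int) :
  (c < +oo)%E -> (forall i, P i -> (c < v (x i))%E) ->
  (c < v (\sum_(i | P i) x i)%R)%E.
Proof.
move=> c_fin cx; elim/big_ind: _ => [|x1 x2|//]; first by rewrite val0.
exact: valD_gt.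
Qed.

Lemma valX_EFin x (k : int) n : v x = k%:E -> v (x ^+ n) = (k * n%:Z)%:E.
Proof.
move=> vx; elim: n => [|n IHn]; first by rewrite expr0 val1 mulr0.
by rewrite exprS valM vx IHn -EFinD; congr (_%:E); lia.
Qed.

Lemma valV_EFin x (k : int) : v x = k%:E -> v x^-1 = (- k)%:E.
Proof.
move=> vx; have x0 := val_neq0 vx.
have [|l vl] := @val_fin x^-1; first by rewrite invr_eq0.
by have := valM x x^-1; rewrite divff // val1 vx vl -EFinD => -[kl]; congr (_%:E); lia.
Qed.

Lemma val_nat_ge0 n : (0 <= v n%:R)%E.
Proof.
elim: n => [|n IHn]; first by rewrite val0 leey.
by rewrite -natr1 valD_ge ?val1.
Qed.

(** A Bézout relation [u * m = w * n + 1] would otherwise exhibit 1 as a difference of two elements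
    of positive valuation. *)
Lemma val_nat_coprime_gt0 m n : coprime m n -> (0 < v m%:R)%E ->
  ~ (0 < v n%:R)%E.
Proof.
case: m => [|m]; first by rewrite /coprime gcd0n => /eqP ->; rewrite mulr1n val1 ltxx.
move=> co_mn m_gt0 n_gt0.
have m0 : (0 < m.+1)%N by [].
have [u w def_u _] := egcdnP n m0.
move: co_mn; rewrite /coprime => /eqP co_mn; rewrite co_mn in def_u.
have pos a b : (0 < v b%:R)%E -> (0 < v (a * b)%:R)%E.
  move=> b_gt0; rewrite natrM valM.
  by apply: lt_le_trans b_gt0 _; rewrite leeDr ?val_nat_ge0.
have := pos u _ m_gt0; rewrite def_u natrD => uw.
have: (0 < v (((w * n)%:R + 1) - (w * n)%:R))%E by rewrite valD_gt ?valN ?pos.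
by rewrite addrC addKr val1 ltxx.
Qed.

Lemma val_ge0M x y : (0 <= v x -> 0 <= v y -> 0 <= v (x * y)%R)%E.
Proof. by move=> x0 y0; rewrite valM adde_ge0. Qed.

Lemma val_horner_ge0 (P : {poly L}) y :
  (forall i, (0 <= v P`_i)%E) -> (0 <= v y)%E -> (0 <= v P.[y])%E.
Proof.
move=> P0 y0; elim/poly_ind: P P0 => [|P c IHP] P0; first by rewrite horner0 val0.
rewrite hornerMXaddC valD_ge ?val_ge0M ?IHP // => [i|].
  by have := P0 i.+1; rewrite coefD coefMX coefC /= addr0.
by have := P0 0%N; rewrite coefD coefMX coefC /= add0r.
Qed.

(** When nonzero terms have distinct valuations, the smallest one is unique and decides the sum. If
    the smallest term is itself 0, then all terms are. *)
Lemma val_sum_min (I : finType) (P : pred I) (x : I -> L) (i0 : I) : P i0 ->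
  (forall i j, P i -> P j -> x i != 0 -> x j != 0 -> v (x i) = v (x j) ->
     i = j) ->
  exists2 i, P i & v (\sum_(i | P i) x i) = v (x i) /\
    forall j, P j -> (v (x i) <= v (x j))%E.
Proof.
move=> Pi0 inj; pose i := [arg min_(i < i0 | P i) v (x i)]%O.
have [Pi imin] : P i /\ forall j, P j -> (v (x i) <= v (x j))%E.
  by rewrite /i; case: Order.TotalTheory.arg_minP.
exists i => //; split=> //; have [xi0|xi0] := eqVneq (x i) 0.
  rewrite xi0 big1 // => j /imin; rewrite xi0 val0 leye_eq => /eqP vj.
  by apply/eqP; apply/negPn/negP => /val_fin_num; rewrite vj.
rewrite (bigD1 i) //= valDl //.
apply: val_sum_gt => [|j /andP[Pj ji]]; first by rewrite ltey_eq val_fin_num.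
rewrite lt_neqAle imin // andbT; have [->|xj0] := eqVneq (x j) 0.
  by case/val_fin: xi0 => k ->; rewrite val0.
by apply/eqP => vij; rewrite (inj i j) ?eqxx in ji.
Qed.

End Valuation.

(** * Polynomials evaluated at an element of known valuation *)

Section HornerValuation.

Variables (K : fieldType) (F : fieldExtType K) (v : F -> \bar int).
Hypothesis vP : normalized_valuation predT v.
Variables (E : {subfield F}) (e : int) (y : F) (s : int).
Hypothesis vE : forall x k, x \in E -> v x = k%:E -> (e %| k)%Z.
Hypothesis vy : v y = s%:E.

(* The terms of [P.[y]] have valuations pairwise distinct modulo [e]. *)
Lemma horner_val_min (P : {poly F}) : P \is a polyOver E -> P != 0 ->
  (forall j : nat, (0 < j < size P)%N -> ~~ (e %| j%:Z * s)%Z) ->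
  exists j : nat, [/\ (j < size P)%N, P`_j != 0, v P.[y] = v (P`_j * y ^+ j) &
    forall i : nat, (i < size P)%N -> (v P.[y] <= v (P`_i * y ^+ i)%R)%E].
Proof.
move=> /polyOverP PE P0 ndvd; have y0 := val_neq0 vP vy.
have sP : (0 < size P)%N by rewrite size_poly_gt0.
rewrite horner_coef.
have vt i : P`_i != 0 -> exists2 k, v (P`_i * y ^+ i) = k%:E & (e %| k - s * i%:Z)%Z.
  case/(val_fin vP) => k vk; exists (k + s * i%:Z).
    by rewrite valM // vk (valX_EFin vP _ vy).
  by rewrite addrK; apply: vE (PE i) vk.
have inj (i j : 'I_(size P)) : (i < j)%N -> P`_i * y ^+ i != 0 ->
    P`_j * y ^+ j != 0 -> v (P`_i * y ^+ i) <> v (P`_j * y ^+ j).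
  move=> ij; rewrite !mulf_eq0 !negb_or => /andP[/vt[k -> ek] _] /andP[/vt[l -> el] _].
  case=> kl; have: ~~ (e %| (j - i)%N%:Z * s)%Z.
    by apply: ndvd; rewrite subn_gt0 ij (leq_ltn_trans (leq_subr _ _)).
  apply/negP; rewrite negbK.
  have -> : (j - i)%N%:Z * s = (k - s * i%:Z) - (l - s * j%:Z).
    by rewrite -subzn 1?ltnW // kl; ring.
  exact: rpredB.
have [//|i j _ _ xi xj vij|i _ [vS imin]] :=
    val_sum_min vP (x := fun i : 'I_(size P) => P`_i * y ^+ i) (P := predT)
      (i0 := Ordinal sP).
  by apply/val_inj; case: (ltngtP i j) => // /inj;
    [case/(_ xi xj)|case/(_ xj xi)].
exists i; rewrite ltn_ord vS; split=> // [|j lt_jP]; last exact: (imin (Ordinal lt_jP)).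
(* The coefficient at the minimum is nonzero, because the minimum is at most the finite valuation of
   the leading term. *)
have /= := imin (Ordinal (etrans (congr1 (leq^~ _) (prednK sP)) (leqnn _))) isT.
rewrite -lead_coefE; have : lead_coef P * y ^+ (size P).-1 != 0.
  by rewrite mulf_neq0 ?lead_coef_eq0 ?expf_neq0.
case/(val_fin vP) => k ->; apply: contraTneq => ->.
by rewrite mul0r (val0 vP).
Qed.

(** This turns valuations into lower bounds on degrees. Without such a [j], [horner_val_min] would
    give the minimal polynomial a finite valuation at its root [y]. *)
Lemma adjoin_degree_val :
  exists2 j : nat, (0 < j <= adjoin_degree E y)%N & (e %| j%:Z * s)%Z.
Proof.
pose d := adjoin_degree E y.
have [/existsP[j /andP[j0 ej]]|/existsPn ndvd] :=
    boolP [exists j : 'I_d.+1, (0 < j)%N && (e %| j%:Z * s)%Z].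
  by exists j => //; rewrite j0 -ltnS ltn_ord.
have [||j /andP[j0]|j [_ cj]] := @horner_val_min (minPoly E y).
- exact: minPolyOver.
- by rewrite monic_neq0 ?monic_minPoly.
- by rewrite size_minPoly => jd; have := ndvd (Ordinal jd); rewrite /= j0.
rewrite minPolyxx (val0 vP); have : (minPoly E y)`_j * y ^+ j != 0.
  by rewrite mulf_neq0 ?expf_neq0 ?(val_neq0 vP vy).
by case/(val_fin vP) => k ->.
Qed.

End HornerValuation.

Lemma EFin_mulrn (k : int) n : (k%:E *+ n)%E = (k * n%:Z)%:E.
Proof.
by elim: n => [|n IHn]; rewrite ?mule0n ?mulr0 // muleS IHn -EFinD; congr (_%:E); lia.
Qed.

(** * Integrals of step functions *)

(** The integrand is constant on each half-open interval from [k] (excluded) to [k + 1]; the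
    induction on [N] starts from a single point, of measure 0. *)
Lemma Rintegral_ceil (R : realType) (c : int -> R) (N : nat) :
  (forall k, 0 <= c k) ->
  Rintegral (@lebesgue_measure R) [set` `[0, N%:R]] (fun t => c (Num.ceil t)) =
  \sum_(0 <= k < N) c k.+1%:Z.
Proof.
move=> c0; pose g (t : measurableTypeR R) := (c (Num.ceil t))%:E.
have ceilN m : {in `]m%:R, m.+1%:R]%classic, g =1 cst (c m.+1%:Z)%:E}.
  move=> t /classical_sets.set_mem /=; rewrite in_itv /= => /andP[mt tm]; congr (c _)%:E.
  apply/eqP; rewrite ceil_eq (_ : m.+1%:Z - 1 = m%:Z); last by lia.
  exact/andP.
suff [_ int_g] : measurable_fun (`[0, N%:R]%classic : set (measurableTypeR R)) g /\
    integral (@lebesgue_measure R) [set` `[0, N%:R]] g =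
    (\sum_(0 <= k < N) c k.+1%:Z)%:E by rewrite /Rintegral int_g.
elim: N => [|N [mg IHN]].
  by rewrite set_itv1 integral_set1 big_geq //; split=> //; exact: measurable_fun_set1.
have -> : (`[0, N.+1%:R] = `[0, N%:R] `|` `]N%:R, N.+1%:R] :> set R)%classic.
  by rewrite -itv_bndbnd_setU // bnd_simp ?ler_nat ?ler0n.
have mgN : measurable_fun (`]N%:R, N.+1%:R]%classic : set (measurableTypeR R)) g.
  exact: eq_measurable_fun (fun t Nt => esym (ceilN N t Nt)) (measurable_cst _).
have int_gN : integral (@lebesgue_measure R) [set` `]N%:R, N.+1%:R]] g = (c N.+1%:Z)%:E.
  rewrite (eq_integral (cst (c N.+1%:Z)%:E)); last exact: ceilN.
  rewrite integral_cst //= lebesgue_measure_itv /= lte_fin ltr_nat ltnSn.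
  by rewrite -EFinB -EFinM -natr1 addrAC subrr add0r mulr1.
split; first by apply/measurable_funU.
rewrite ge0_integral_setU //=.
- by rewrite IHN int_gN -EFinD big_nat_recr.
- exact/measurable_funU.
- by move=> t _; rewrite lee_fin.
apply/disj_setPS => t [/=]; rewrite !in_itv /= => /andP[_ tN] /andP[].
by rewrite ltNge tN.
Qed.

Lemma intr_div_int (R : archiRealFieldType) (m : int) (d : nat) : (0 < d)%N ->
  (m%:~R / d%:R \is a @Num.int R) = (d%:Z %| m)%Z.
Proof.
move=> d0; have d0R : d%:R != 0 :> R by rewrite pnatr_eq0 -lt0n.
apply/intrP/dvdzP => -[k mk]; exists k; last by rewrite mk intrM mulfK.
by apply: (@intr_inj R); rewrite intrM -mk mulfVK.
Qed.

(** * Totally ramified extensions *)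

Section TotallyRamified.

Variables (K : fieldType) (F : splittingFieldType K).
Variables (vK : K -> \bar int) (vF : F -> \bar int) (pi : F).
Hypothesis vKP : normalized_valuation predT vK.
Hypothesis vFP : normalized_valuation predT vF.
Hypothesis F_tot : totally_ramified vK vF.
Hypothesis pi_unif : vF pi = 1%:E.

Let n := \dim {:F}.

Lemma val_in_alg (a : K) (k : int) : vK a = k%:E -> vF a%:A = (k * n%:Z)%:E.
Proof. by case: F_tot => _ -> ->; rewrite EFin_mulrn. Qed.

Lemma ex_val_in_alg (k : int) :
  exists2 a : K, a != 0 & vF a%:A = (k * n%:Z)%:E.
Proof.
case: vKP => _ _ _ _ /(_ k) [a _ va].
by exists a; [exact: (val_neq0 vKP va) | exact: val_in_alg].
Qed.

Lemma mem_base (a : K) : (a%:A : F) \in 1%AS.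
Proof. by apply/vlineP; exists a. Qed.

Lemma val_base_dvd x k : x \in 1%AS -> vF x = k%:E -> (n%:Z %| k)%Z.
Proof.
case/vlineP=> a -> va; have a0 : a != 0.
  by apply: contra_eq_neq va => ->; rewrite scale0r (val0 vFP).
have [l vl] := val_fin vKP a0; move: va; rewrite (val_in_alg vl) => -[<-].
exact: dvdz_mull.
Qed.

Lemma val_base_ge0 x : x \in 1%AS -> ((- n%:Z)%:E < vF x)%E -> (0 <= vF x)%E.
Proof.
move=> xK; have [->|/(val_fin vFP)[k vk]] := eqVneq x 0; first by rewrite (val0 vFP).
have /dvdzP[q kq] := val_base_dvd xK vk.
have n0 : 0 < n%:Z :> int by rewrite ltz_nat adim_gt0.
rewrite vk lte_fin lee_fin kq -mulN1r ltr_pM2r // pmulr_lge0 //.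
Qed.

(** Values of [K] are multiples of [n] and [pi] has value 1, so [pi] has degree at least [n] over
    [K]. *)
Lemma adjoin_unif : <<1; pi>>%VS = fullv.
Proof.
have [j /andP[j0 jd]] := adjoin_degree_val vFP val_base_dvd pi_unif.
rewrite mulr1 dvdzE /= => /dvdn_leq -/(_ j0) nj.
apply/eqP; rewrite eqEdim subvf /= dim_Fadjoin dimv1 muln1.
exact: leq_trans nj jd.
Qed.

(** The valuation ring of [F] is that of [K] with [pi] adjoined. The terms of [P.[pi]] have values
    distinct modulo [n], so each is at least [vF x]. Exponents being below [n], a coefficient has
    value above [- n], hence nonnegative as a multiple of [n]. *)
Lemma unif_expansion x : (0 <= vF x)%E ->
  exists P : {poly F}, [/\ P \is a polyOver 1%AS, (size P <= n)%N, P.[pi] = x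
    & forall i, (0 <= vF P`_i)%E].
Proof.
move=> x0; pose P := Fadjoin_poly 1 pi x.
have PK : P \is a polyOver 1%AS by exact: Fadjoin_polyOver.
have Px : P.[pi] = x by rewrite Fadjoin_poly_eq // adjoin_unif memvf.
have sP : (size P <= n)%N.
  apply: leq_trans (size_Fadjoin_poly _ _ _) _.
  by have := dim_Fadjoin 1 pi; rewrite adjoin_unif dimv1 muln1 => <-.
exists P; split=> // i.
have [i_ge|i_lt] := leqP (size P) i; first by rewrite nth_default // (val0 vFP).
have P0 : P != 0 by rewrite -size_poly_gt0; apply: leq_ltn_trans i_lt.
have [j /andP[j0 jP]|j [_ _ _ /(_ _ i_lt)]] :=
    horner_val_min vFP val_base_dvd pi_unif PK P0.
  rewrite mulr1 dvdzE /=; apply/negP => /dvdn_leq -/(_ j0).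
  by rewrite leqNgt (leq_trans jP).
rewrite Px => /(le_trans x0); rewrite (valM vFP) (valX_EFin vFP _ pi_unif) mul1r => ge0.
apply: val_base_ge0; first exact: (polyOverP PK).
have [->|/(val_fin vFP)[k vk]] := eqVneq P`_i 0; first by rewrite (val0 vFP) ltry.
by move: ge0; rewrite vk -EFinD lee_fin lte_fin; have := leq_trans i_lt sP; lia.
Qed.

(** The residue field does not grow: in the expansion of [x], everything beyond the constant
    coefficient is divisible by [pi]. *)
Lemma val_residue x : (0 <= vF x)%E -> exists a : K, (0 < vF (x - a%:A)%R)%E.
Proof.
case/unif_expansion => P [/polyOverP PK _ <- P_ge0].
have /vlineP[a Pa] := PK 0%N; exists a; rewrite -Pa.
elim/poly_ind: P P_ge0 {PK Pa} => [|P c _] P_ge0.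
  by rewrite horner0 coef0 subr0 (val0 vFP).
rewrite hornerMXaddC coefD coefMX coefC /= add0r addrK (valM vFP) pi_unif.
have: (0 <= vF P.[pi])%E.
  apply: (val_horner_ge0 vFP) => [i|]; last by rewrite pi_unif lee_fin.
  by have := P_ge0 i.+1; rewrite coefD coefMX coefC /= addr0.
move=> ge0; apply: lt_le_trans (leeD ge0 (lexx _)).
by rewrite add0e lte_fin.
Qed.

(** * Invariance of the valuation under the Galois group *)

Lemma gal_base (s : gal_of {:F}) x : s \in 'Gal({:F} / 1)%g -> x \in 1%AS -> s x = x.
Proof. by move=> sG xK; apply: (fixed_gal (sub1v _) sG). Qed.

Lemma val_comp_gal (s : gal_of {:F}) : normalized_valuation predT (vF \o s).
Proof.
case: (vFP) => v0 vfin vM vD vsurj; split=> [|x _ x0|x y _ _|x y _ _|k] /=.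
- by rewrite rmorph0.
- by rewrite vfin // fmorph_eq0.
- by rewrite rmorphM vM.
- by rewrite rmorphD vD.
have [x _ vx] := vsurj k; exists (s^-1%g x) => //=.
by rewrite -galM ?memvf // mulVg gal_id.
Qed.

(* [pi] is integral over the valuation ring of [K]: [pi ^+ n = c u] with [c] a
   uniformizer of [K] and [u] a polynomial in [pi] with integral coefficients. *)
Lemma val_gal_unif_ge0 (s : gal_of {:F}) : s \in 'Gal({:F} / 1)%g -> (0 <= vF (s pi))%E.
Proof.
move=> sG; have sP := val_comp_gal s.
have [|l /= vspi] := @val_fin _ _ sP pi; first exact: val_neq0 vFP _ _ pi_unif.
rewrite leNgt vspi lte_fin; apply/negP => l0.
have [c c0 vc] := ex_val_in_alg 1; rewrite mul1r in vc.
have cA0 := val_neq0 vFP vc.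
have vu : vF (pi ^+ n / c%:A) = 0%E.
  rewrite (valM vFP) (valX_EFin vFP _ pi_unif) (valV_EFin vFP vc) -EFinD.
  by congr (_%:E); lia.
have [|P [PK sizeP Pu P_ge0]] := unif_expansion (x := pi ^+ n / c%:A).
  by rewrite vu.
(* As [l < 0] and exponents are at most [n - 1], no term has value below [l (n - 1)]. With [s (pi ^+
   n) = c * s P.[pi]] this yields [l n >= n + l (n - 1)], that is [l >= n], a contradiction. *)
have vPu : ((l * (n.-1)%:Z)%:E <= vF (s P.[pi]))%E.
  rewrite horner_coef rmorph_sum /=.
  elim/big_ind: _ => [||i _]; [by rewrite (val0 vFP) leey|by move=> *; apply: valD_ge|].
  rewrite rmorphM rmorphXn /= (gal_base sG (polyOverP PK _)) (valM vFP).
  rewrite (valX_EFin vFP _ vspi); apply: le_trans (leeD (P_ge0 i) (lexx _)).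
  rewrite add0e lee_fin; have := leq_trans (ltn_ord i) sizeP; nia.
have : s (pi ^+ n) = c%:A * s P.[pi].
  rewrite Pu rmorphM fmorphV /= (gal_base sG (mem_base c)).
  by rewrite mulrCA divff // mulr1.
move/(congr1 vF); rewrite rmorphXn /= (valX_EFin vFP _ vspi) (valM vFP) vc => eq.
have := leeD (lexx n%:Z%:E) vPu; rewrite -eq -EFinD lee_fin.
have : (0 < n)%N by rewrite adim_gt0.
by clearbody n; nia.
Qed.

Lemma val_gal_ge0 (s : gal_of {:F}) x :
  s \in 'Gal({:F} / 1)%g -> (0 <= vF x)%E -> (0 <= vF (s x))%E.
Proof.
move=> sG /unif_expansion[P [/polyOverP PK _ <- P_ge0]].
apply: (val_horner_ge0 (val_comp_gal s)) => [i|]; last exact: val_gal_unif_ge0.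
by rewrite /= (gal_base sG).
Qed.

(* Write [x ^+ n = c u] with [c] in [K] and [u] a unit; [val_gal_ge0] applied to
   [u] and [u^-1] shows that [s u] is a unit. *)
Lemma val_gal (s : gal_of {:F}) x : s \in 'Gal({:F} / 1)%g -> vF (s x) = vF x.
Proof.
move=> sG; have [->|x0] := eqVneq x 0; first by rewrite rmorph0.
have sx0 : s x != 0 by rewrite fmorph_eq0.
have [[k vx] [l vsx]] := (val_fin vFP x0, val_fin vFP sx0).
have [c c0 vc] := ex_val_in_alg k.
have cA := mem_base c.
have ge0 (y z : F) : vF y = vF z -> y != 0 -> (0 <= vF (s (y / z)%R))%E.
  move=> vyz y0; have [m vy] := val_fin vFP y0.
  apply: val_gal_ge0 => //; rewrite (valM vFP) vy (valV_EFin vFP (k := m)) -?vyz //.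
  by rewrite -EFinD subrr.
have vxc : vF (x ^+ n) = vF c%:A by rewrite vc (valX_EFin vFP _ vx).
have := ge0 _ _ vxc (expf_neq0 _ x0).
have := ge0 _ _ (esym vxc) (val_neq0 vFP vc).
rewrite !rmorphM !fmorphV rmorphXn /= (gal_base sG cA) !(valM vFP).
rewrite (valX_EFin vFP _ vsx) (valV_EFin vFP vc).
rewrite (valV_EFin vFP (valX_EFin vFP _ vsx)) vc vx -!EFinD !lee_fin => kl lk.
rewrite vsx; congr (_%:E); have : (0 < n)%N by rewrite adim_gt0.
by clearbody n; nia.
Qed.

(** * Lower ramification groups and wildness *)

Lemma lower_ram_group_set j : group_set (lower_ram vF pi j).
Proof.
apply/group_setP; split=> [|s t].
  by rewrite inE group1 gal_id subrr (val0 vFP) leey.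
rewrite !inE => /andP[sG sj] /andP[tG tj]; rewrite groupM //= galM ?memvf //.
rewrite -(subrKA (t pi)) -rmorphB; apply: (valD_ge vFP) => //.
by rewrite val_gal.
Qed.

Canonical lower_ram_group j := Group (lower_ram_group_set j).

Lemma lower_ramS j k : j <= k -> lower_ram vF pi k \subset lower_ram vF pi j.
Proof.
move=> jk; apply/fintype.subsetP => s; rewrite !inE => /andP[-> sk] /=.
by apply: le_trans sk; rewrite lee_fin lerD2r.
Qed.

(** Write [y = pi ^+ k * u] with [u] a unit. The residue of [u] comes from [K], so [s u - u] has
    positive value; the powers of [pi] are handled by wildness. *)
Lemma val_wild_sub (s : gal_of {:F}) y (k : nat) :
  s \in 'Gal({:F} / 1)%g -> (2%:E <= vF (s pi - pi)%R)%E ->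
  vF y = k%:Z%:E -> (vF y < vF (s y - y)%R)%E.
Proof.
move=> sG s1; have vpiX m : vF (pi ^+ m) = m%:Z%:E.
  by rewrite (valX_EFin vFP _ pi_unif) mul1r.
have pi_mul m (u : F) : vF u = 0%E -> (0 < vF (s u - u)%R)%E ->
    (m%:Z%:E < vF (s (pi ^+ m * u) - pi ^+ m * u)%R)%E.
  move=> vu su; elim: m => [|m IHm]; first by rewrite expr0 mul1r.
  (* Twisted Leibniz rule for [s - 1]: the first summand gains 1 over the induction hypothesis, the
     second has value at least [m + 2]. *)
  have -> : s (pi ^+ m.+1 * u) - pi ^+ m.+1 * u =
      s pi * (s (pi ^+ m * u) - pi ^+ m * u) + (s pi - pi) * (pi ^+ m * u).
    by rewrite !rmorphM !rmorphXn /= !exprS; ring.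
  apply: (valD_gt vFP); rewrite (valM vFP).
    by rewrite val_gal // pi_unif -addn1 PoszD addrC EFinD lteD2lE.
  apply: lt_le_trans (leeD s1 (lexx _)).
  by rewrite (valM vFP) vu adde0 vpiX -EFinD lte_fin; lia.
move=> vy; have vu : vF (y / pi ^+ k) = 0%E.
  by rewrite (valM vFP) vy (valV_EFin vFP (vpiX k)) -EFinD subrr.
have -> : y = pi ^+ k * (y / pi ^+ k).
  by rewrite mulrCA divff ?mulr1 // expf_neq0 // (val_neq0 vFP pi_unif).
rewrite (valM vFP) vu adde0 vpiX; apply: pi_mul => //.
have [|a va] := @val_residue (y / pi ^+ k); first by rewrite vu.
set u := y / _ in va *.
have -> : s u - u = s (u - a%:A) - (u - a%:A).
  by rewrite rmorphB /= (gal_base sG (mem_base a)); ring.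
by rewrite (valD_gt vFP) ?(valN vFP) ?val_gal.
Qed.

Lemma gal_eq1 (s : gal_of {:F}) : s \in 'Gal({:F} / 1)%g -> s pi = pi -> s = 1%g.
Proof.
move=> sG spi; apply/eqP/gal_eqP => x _; rewrite gal_id.
have : x \in <<1; pi>>%VS by rewrite adjoin_unif memvf.
case/Fadjoin_polyP => P PK ->.
by rewrite -horner_map /= (fixedPoly_gal (sub1v _) sG) ?spi.
Qed.

(* If [s] has prime order [l] and [d = s pi - pi], then [s ^ m pi - pi] equals
   [m d] up to higher valuation, so [m = l] forces [l] to have valuation [> 0]. *)
Lemma gal_pgroup (p : nat) : residue_char vK p ->
  'Gal({:F} / 1)%g = lower_ram vF pi 1 :> {set _} -> (p.-group 'Gal({:F} / 1))%g.
Proof.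
case=> p_prime vp G1; apply/pgroupP => l l_prime /(Cauchy l_prime)[s sG ords].
rewrite inE; apply/negPn/negP => l_p.
have s1 : (2%:E <= vF (s pi - pi)%R)%E.
  by have: s \in lower_ram vF pi 1 by [rewrite -G1]; rewrite inE => /andP[].
have [d0|d_neq0] := eqVneq (s pi - pi) 0.
  move: ords; rewrite (gal_eq1 sG) ?order1; last by apply/eqP; rewrite -subr_eq0 d0.
  by move=> l1; rewrite -l1 in l_prime.
have [k vd] := val_fin vFP d_neq0; pose d := s pi - pi.
have sd : (vF d < vF (s d - d)%R)%E.
  have [m km] : exists m : nat, k = m%:Z.
    by exists `|k|%N; move: s1; rewrite vd lee_fin; lia.
  by apply: (val_wild_sub (k := m)); rewrite // vd km.
have expand m : (vF d < vF ((s ^+ m)%g pi - pi - d *+ m)%R)%E.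
  elim: m => [|m IHm].
    by rewrite expg0 gal_id mulr0n subr0 subrr (val0 vFP) vd ltry.
  have -> : (s ^+ m.+1)%g pi - pi - d *+ m.+1 =
      s ((s ^+ m)%g pi - pi - d *+ m) + (s d - d) * m%:R.
    rewrite expgSr galM ?memvf // !rmorphB /= rmorphMn /= mulrSr -mulr_natr.
    by rewrite mulrBl mulr_natr mulr_natr /d; ring.
  apply: (valD_gt vFP); first by rewrite val_gal.
  rewrite (valM vFP); apply: lt_le_trans sd _.
  by rewrite leeDl // (val_nat_ge0 vFP).
(* Since [s ^ l] is trivial, the expansion at [l] says [vF d < vF (d *+ l)]. *)
have := expand l; rewrite -ords expg_order gal_id subrr sub0r (valN vFP) ords.
rewrite -mulr_natr (valM vFP) vd lteDl // => vl.
apply: (val_nat_coprime_gt0 vFP _ vl (n := p)).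
  by rewrite prime_coprime // dvdn_prime2.
(* The positive value of [p] in [K], which is [+oo] in characteristic [p], stays positive when
   multiplied by the ramification index. *)
have -> : (p%:R : F) = (p%:R)%:A by rewrite -in_algE rmorph_nat.
case: F_tot => n0 ->; rewrite -/n in n0 *.
case: (n) n0 vp => // m _; case: (vK _) => [a| |] //; last by rewrite enatmul_pinfty.
by rewrite EFin_mulrn !lte_fin => a0; rewrite mulr_gt0.
Qed.

(** * Valuations of intermediate fields and minimal polynomials *)

Lemma val_below_dvd (E : {subfield F}) (w : F -> \bar int) (e : nat) :
    normalized_valuation (mem E) w -> {in E, forall x, vF x = (w x *+ e)%E} ->
  forall x k, x \in E -> vF x = k%:E -> (e%:Z %| k)%Z.
Proof.
move=> [_ wfin _ _ _] we x k xE vx; have := we x xE.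
rewrite -(fineK (wfin x xE (val_neq0 vFP vx))) EFin_mulrn vx => -[->].
exact: dvdz_mull.
Qed.

(** The index [e] equals [[F : E]] by two degree bounds. The degree of [pi] over [E] is at least
    [e]. Conversely, an element of [E] with [w]-value 1 has [vF]-value [e] and degree at most
    [[E : K]] over [K], so [[F : K] <= [E : K] e]. *)
Lemma val_below (E : {subfield F}) (w : F -> \bar int) :
    normalized_valuation_below vF E w ->
  {in E, forall x, vF x = (w x *+ \dim_E {:F})%E}.
Proof.
move=> [wP [e e0 we]]; suff <-: e = \dim_E {:F} by [].
have dimFE : \dim {:F} = (\dim_E {:F} * \dim E)%N by rewrite -dim_sup_field ?subvf.
have dimE0 : (0 < \dim E)%N by rewrite adim_gt0.
apply/eqP; rewrite eqn_leq; apply/andP; split.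
  have [j /andP[j0 jd]] := adjoin_degree_val vFP (val_below_dvd wP we) pi_unif.
  rewrite mulr1 dvdzE /= => /dvdn_leq -/(_ j0) ej.
  apply: leq_trans ej (leq_trans jd _).
  by rewrite -(leq_pmul2r dimE0) -dimFE -dim_Fadjoin dimvS ?subvf.
case: (wP) => _ _ _ _ /(_ 1) [x xE wx].
have vx : vF x = e%:Z%:E by rewrite we // wx EFin_mulrn mul1r.
have [j /andP[j0 jd]] := adjoin_degree_val vFP val_base_dvd vx.
rewrite -PoszM dvdzE /= => /dvdn_leq; rewrite muln_gt0 j0 => /(_ e0) nj.
have jE : (j <= \dim E)%N.
  apply: leq_trans jd _; have := dim_Fadjoin 1 x; rewrite dimv1 muln1 => <-.
  by apply/dimvS/FadjoinP; rewrite sub1v.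
rewrite -(leq_pmul2r dimE0) -dimFE; apply: leq_trans nj _.
by rewrite mulnC leq_mul2l jE orbT.
Qed.

(* If the middle part [mid] of the minimal polynomial did not have valuation
   larger than that of [f ^+ q], its valuation would be that of the constant term,
   although it is not in the value group of [E]. *)
Lemma minPoly_lead (E E' : {subfield F}) (e : nat) (b : int) (f : F) :
    (E <= E')%VS -> (0 < e)%N ->
    (forall x k, x \in E -> vF x = k%:E -> ((e * \dim_E E')%N%:Z %| k)%Z) ->
    f \in E' -> vF f = (- b * e%:Z)%:E -> coprime `|b| (\dim_E E') ->
  plus_higher vF ((minPoly E f).[f] - (minPoly E f).[0]) (f ^+ \dim_E E').
Proof.
move=> EE' e0; set q := \dim_E E' => vE fE' vf co_bq; set m := minPoly E f.
have dimE' : \dim E' = (q * \dim E)%N by rewrite -dim_sup_field.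
have q0 : (0 < q)%N by have := adim_gt0 E'; rewrite dimE' muln_gt0 => /andP[].
(* Because [b] is prime to [q], no [j b] with [0 < j < q] is divisible by [q]. This forces [f] to
   have degree exactly [q] and separates the values of the terms. *)
have ndvd j : (0 < j < q)%N -> ~~ ((e * q)%N%:Z %| j%:Z * (- b * e%:Z))%Z.
  case/andP=> j0 jq; rewrite dvdzE !abszM abszN /= mulnA.
  rewrite [X in (_ %| X)%N]mulnC dvdn_pmul2l //.
  rewrite Gauss_dvdl 1?coprime_sym //; apply/negP => /dvdn_leq -/(_ j0).
  by rewrite leqNgt jq.
have deg_f : adjoin_degree E f = q.
  apply/eqP; rewrite eqn_leq; apply/andP; split.
    rewrite -(leq_pmul2r (adim_gt0 E)) -dimE' -dim_Fadjoin.
    by apply/dimvS/FadjoinP.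
  have [j /andP[j0 jd]] := adjoin_degree_val vFP vE vf.
  by case: (leqP q j) => [/leq_trans ->//|jq]; rewrite (negPf (ndvd _ _)) ?j0.
have mE : m \is a polyOver E by exact: minPolyOver.
have mf : m.[f] = 0 by exact: minPolyxx.
have size_m : size m = q.+1 by rewrite size_minPoly deg_f.
have lead_m : m`_q = 1.
  by have := monic_minPoly E f; rewrite monicE lead_coefE size_minPoly deg_f => /eqP.
clearbody m; have m0E : m.[0] \in E by rewrite horner_coef0 (polyOverP mE).
have fq0 : f ^+ q != 0 by rewrite expf_neq0 ?(val_neq0 vFP vf).
have vfq : vF (f ^+ q) = (- b * (e * q)%N%:Z)%:E.
  by rewrite (valX_EFin vFP _ vf) -mulrA PoszM.
pose mid := m - m.[0]%:P - 'X^q.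
have midf : m.[f] - m.[0] = f ^+ q + mid.[f].
  rewrite /mid hornerD hornerN hornerXn hornerD hornerN hornerC.
  by rewrite [RHS]addrC subrK.
exists mid.[f] => //; have [->|mid0] := eqVneq mid 0.
  by rewrite horner0 (val0 vFP) vfq ltry.
have mid_size : (size mid <= q)%N.
  apply/leq_sizeP => j qj; have j0 := leq_trans q0 qj.
  rewrite !coefB coefC coefXn (gtn_eqF j0) subr0.
  have [->|jq] := eqVneq j q; last first.
    by rewrite subr0 nth_default // size_m ltn_neqAle eq_sym jq.
  by rewrite lead_m subrr.
have midE : mid \is a polyOver E by rewrite !rpredB ?polyOverC ?rpredX ?polyOverX.
have [j /andP[j0 jq]|j [jq midj vmid _]] := horner_val_min vFP vE vf midE mid0.
  by apply: ndvd; rewrite j0 (leq_trans jq).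
(* [mid] has no constant term, so the dominant index lies strictly between 0 and [q], where [ndvd]
   applies. *)
have j0 : (0 < j)%N.
  case: j midj {vmid jq} => // /negP[]; rewrite !coefB coefC coefXn (ltn_eqF q0).
  by rewrite /= -horner_coef0 subrr subr0.
have [k vk] := val_fin vFP midj.
have{vmid} vmid : vF mid.[f] = (k + j%:Z * (- b * e%:Z))%:E.
  by rewrite vmid (valM vFP) vk (valX_EFin vFP _ vf) [X in _ = (_ + X)%:E]mulrC.
have vmid_ndvd l : vF mid.[f] = l%:E -> ~~ ((e * q)%N%:Z %| l)%Z.
  rewrite vmid => -[<-]; rewrite rpredDl ?ndvd ?j0 ?(leq_trans jq) //.
  exact: vE (polyOverP midE _) vk.
rewrite ltNge; apply/negP; rewrite le_eqVlt => /orP[/eqP vmq|vmq].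
  by have := vmid_ndvd _ (etrans vmq vfq); rewrite dvdz_mull.
have := vmid_ndvd _ vmid; rewrite (vE (m.[0])) // -vmid -(valDl vFP vmq).
by rewrite addrC -midf mf sub0r (valN vFP).
Qed.

Lemma plus_higher_below (E : {subfield F}) (w : F -> \bar int) x y :
    normalized_valuation_below vF E w -> x \in E -> y \in E ->
  plus_higher w x y <-> plus_higher vF x y.
Proof.
move=> [_ [e e0 we]] xE yE.
have lt_we : {in E &, forall x y, (vF x < vF y)%E = (w x < w y)%E}.
  move=> a c aE cE; rewrite !we //; case: e e0 {we} => // e _.
  case: (w a) (w c) => [k| |] [l| |];
    rewrite ?enatmul_pinfty ?enatmul_ninfty ?EFin_mulrn ?ltxx ?ltry ?ltNyr ?ltNyy //.
  by rewrite !lte_fin ltr_pM2r.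
by split=> -[z xyz yz]; exists z => //; move: yz; rewrite lt_we //;
  rewrite -(addKr y z) -xyz rpredD ?rpredN.
Qed.

Lemma plus_higher_val (x y : F) : plus_higher vF x y -> vF x = vF y.
Proof. by case=> z -> yz; rewrite (valDl vFP). Qed.

Lemma dim_over_gt0 (E : {subfield F}) : (0 < \dim_E {:F})%N.
Proof. by rewrite divn_gt0 ?adim_gt0 ?dimvS ?subvf. Qed.

(** * Leading forms in one step of the tower *)

Section LeadingForm.

Variables (E E' : {subfield F}) (w w' : F -> \bar int) (f g : F) (b b' : int).
Hypotheses (EE' : (E <= E')%VS) (wP : normalized_valuation_below vF E w)
  (wP' : normalized_valuation_below vF E' w').
Hypotheses (fE' : f \in E') (wf : w' f = (- b)%:E).
Hypotheses (gE : g \in E) (wg : w g = (- b')%:E).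
Hypothesis co_b : coprime `|b| (\dim_E E').

Let dim_tower : \dim_E {:F} = (\dim_E' {:F} * \dim_E E')%N.
Proof.
apply/eqP; rewrite -(eqn_pmul2r (adim_gt0 E)) -mulnA.
by rewrite -!dim_sup_field ?subvf.
Qed.

Let val_f : vF f = (- b * (\dim_E' {:F})%:Z)%:E.
Proof. by rewrite (val_below wP') // wf EFin_mulrn. Qed.

Let val_g : vF g = (- b' * (\dim_E {:F})%:Z)%:E.
Proof. by rewrite (val_below wP) // wg EFin_mulrn. Qed.

Let minPoly0_in : (minPoly E f).[0] \in E.
Proof. by rewrite horner_coef0 (polyOverP (minPolyOver _ _)). Qed.

Let scale_in c : c *: g \in E.
Proof. by rewrite memvZ. Qed.

Let minPoly_f : plus_higher vF ((minPoly E f).[f] - (minPoly E f).[0]) (f ^+ \dim_E E').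
Proof.
apply: minPoly_lead val_f co_b => //.
  exact: dim_over_gt0.
case: wP => wN _; rewrite -dim_tower.
exact: val_below_dvd wN (val_below wP).
Qed.

Let val_minPoly0 : vF (- (minPoly E f).[0]) = (- b * (\dim_E {:F})%:Z)%:E.
Proof.
have := plus_higher_val minPoly_f; rewrite minPolyxx sub0r => ->.
by rewrite (valX_EFin vFP _ val_f) -mulrA -PoszM -dim_tower.
Qed.

(** The equality and the leading term on the left hold for every [c], by [minPoly_f]; only the right
    side is a condition, and [vF] tests it as well as [w']. *)
Lemma leading_formP c :
  leading_form w' E E' f g c <-> plus_higher vF (- (minPoly E f).[0]) (c *: g).
Proof.
have sub x : x \in E -> x \in E' by apply: (subvP EE').
have mE' := sub _ minPoly0_in; have cgE' := sub _ (scale_in c).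
rewrite -(plus_higher_below wP') ?rpredN //; split=> [[]//|lead].
split=> //; first by rewrite minPolyxx sub0r.
by apply/(plus_higher_below wP'); rewrite // ?rpredX // minPolyxx sub0r rpredN.
Qed.

Lemma leading_form_val c : leading_form w' E E' f g c ->
  (w' f *+ \dim_E E')%E = w' (c *: g).
Proof.
move=> lead; have lead_c := (leading_formP c).1 lead.
have : vF (f ^+ \dim_E E') = vF (c *: g).
  by rewrite -(plus_higher_val lead_c) -(plus_higher_val minPoly_f) minPolyxx sub0r.
have cgE' : c *: g \in E' by apply: (subvP EE').
rewrite (valX_EFin vFP _ val_f) wf EFin_mulrn => vcg.
have cg0 := val_neq0 vFP (esym vcg).
case: (wP') => [[_ w'fin _ _ _] _]; have := w'fin _ cgE' cg0.
move: vcg; rewrite (val_below wP') //.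
case: (w' _) => [k| |] //; rewrite EFin_mulrn => -[bk] _; congr (_%:E).
apply: (@mulIf _ (\dim_E' {:F})%:Z); first by rewrite eqz_nat -lt0n dim_over_gt0.
by rewrite -bk; ring.
Qed.

(** [\dim E] is [[E : K]], and nonzero constants of [K] have [w]-values exactly the multiples of it.
    Necessity compares values; sufficiency first matches values, then residues. *)
Lemma leading_form_exists :
  (exists2 c : K, c != 0 & leading_form w' E E' f g c) <->
  ((\dim E)%:Z %| b - b')%Z.
Proof.
have dimF : n = (\dim_E {:F} * \dim E)%N by rewrite -dim_sup_field ?subvf.
have val_cg c k : vK c = k%:E ->
    vF (c *: g) = ((k * (\dim E)%:Z - b') * (\dim_E {:F})%:Z)%:E.
  move=> vc; rewrite -mulr_algl (valM vFP) (val_in_alg vc) val_g dimF PoszM -EFinD.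
  by congr (_%:E); ring.
split=> [[c c0 /leading_formP/plus_higher_val]|/dvdzP[k bk]].
  have [k vc] := val_fin vKP c0.
  rewrite val_minPoly0 (val_cg c k) // => -[] /(mulIf _) eqb.
  have {}eqb : - b = k * (\dim E)%:Z - b'.
    by apply: eqb; rewrite eqz_nat -lt0n dim_over_gt0.
  by apply/dvdzP; exists (- k); rewrite -[b]opprK eqb; ring.
(* The value [- k] gives [c *: g] the same valuation as [- m(0)]. Their quotient is then a unit with
   a residue [a] from [K], and [c * a] is the required constant. *)
case: (vKP) => _ _ _ _ /(_ (- k)) [c _ vc]; have c0 := val_neq0 vKP vc.
have vcg : vF (c *: g) = vF (- (minPoly E f).[0]).
  by rewrite val_minPoly0 (val_cg _ _ vc); congr (_ * _)%:E; rewrite mulNr -bk; ring.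
have cg0 : c *: g != 0 by apply: (val_neq0 vFP (etrans vcg val_minPoly0)).
have vu : vF (- (minPoly E f).[0] / (c *: g)) = 0%E.
  rewrite (valM vFP) val_minPoly0 (valV_EFin vFP (etrans vcg val_minPoly0)).
  by rewrite -EFinD subrr.
have [|a va] := val_residue (x := - (minPoly E f).[0] / (c *: g)); first by rewrite vu.
have a0 : a != 0.
  by apply: contraTneq va => ->; rewrite scale0r subr0 vu ltxx.
exists (c * a); first by rewrite mulf_neq0.
apply/leading_formP; set x := - _ in vcg vu va *.
have cag : (c * a) *: g = c *: g * a%:A by rewrite -scalerAr mulr1 scalerA mulrC.
pose z := c *: g * (x / (c *: g) - a%:A).
have xz : x = (c * a) *: g + z.
  by rewrite cag /z mulrBr [_ * (x / _)]mulrCA divff // mulr1 addrC subrK.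
have vxz : (vF x < vF z)%E by rewrite /z (valM vFP) vcg lteDl // val_minPoly0.
exists z => //; rewrite -[(c * a) *: g](addrK z) -xz.
by rewrite (valDl vFP) // (valN vFP z).
Qed.

End LeadingForm.

(** * Ramification jumps *)

Section Jumps.

Variables (h : nat) (b : nat -> int).
Hypothesis F_wild : no_tame_part vF pi.
Hypothesis b_jumps : lower_jumps vF pi h b.

(** Neither -1 nor 0 is a jump, since [G_0] is the whole group and equals [G_1]. *)
Lemma jump_gt0 i : (1 <= i <= h)%N -> 0 < b i.
Proof.
case: F_wild => G0 G01 _; move=> i_h.
have : is_lower_jump vF pi (b i) by apply/b_jumps.2; exists i.
case=> b_ge /proper_subn; rewrite ltNge; apply: contra => b_le0.
have [->|->] : b i = -1 \/ b i = 0 by lia.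
  by rewrite addNr -G0; apply/fintype.subsetP => s; rewrite inE => /andP[].
by rewrite add0r G01.
Qed.

Lemma jumpS i k : (1 <= i)%N -> (i <= k <= h)%N -> b i <= b k.
Proof.
move=> i1 /andP[]; rewrite leq_eqVlt => /orP[/eqP ->//|ik kh].
exact/ltW/b_jumps.1.
Qed.

(** Going down from [b i] to [j], a strict growth of the group would occur at some jump [b k]; but
    [b k] is below [j] for [k < i] and at least [b i] for [k >= i]. *)
Lemma lower_ram_step i j : (1 <= i <= h)%N -> 0 <= j <= b i ->
    (forall k, (1 <= k < i)%N -> b k < j) ->
  lower_ram vF pi j = lower_ram vF pi (b i).
Proof.
move=> /andP[i1 ih] /andP[j0 j_le] b_lt.
suff main m : j <= b i - m%:Z -> lower_ram vF pi (b i - m%:Z) = lower_ram vF pi (b i).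
  have -> : j = b i - `|b i - j|%N%:Z by lia.
  by apply: main; lia.
elim: m => [|m IHm] jm; first by rewrite subr0.
rewrite -IHm; last by lia.
have -> : b i - m%:Z = b i - m.+1%:Z + 1 by lia.
apply/eqP; rewrite finset.eqEsubset [X in _ && X]lower_ramS ?lerDl // andbT.
apply/negPn/negP => not_sub.
have : is_lower_jump vF pi (b i - m.+1%:Z).
  by split; [lia | rewrite fintype.properE lower_ramS ?lerDl // not_sub].
case/b_jumps.2 => k /andP[k1 kh] bk.
have [ki|ik] := ltnP k i; first by have := b_lt k; rewrite k1 ki => /(_ isT); lia.
by have := @jumpS i k; rewrite i1 ik kh => /(_ isT isT); lia.
Qed.

Lemma lower_ram0 : lower_ram vF pi 0 = 'Gal({:F} / 1)%g.
Proof. by case: F_wild. Qed.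

Lemma lower_ram_jump1 : (1 <= h)%N -> lower_ram vF pi (b 1) = lower_ram vF pi 0.
Proof.
move=> h1; rewrite -(lower_ram_step (i := 1) (j := 0)) ?h1 //=.
  by rewrite ltW // jump_gt0 // h1.
by case.
Qed.

Lemma jump_group_group_set i : group_set (jump_group vF pi h b i).
Proof. by rewrite /jump_group; case: ifP => _; apply: groupP. Qed.

Let J i := Group (jump_group_group_set i).

Lemma dim_over_tower i : \dim_(tower vF pi h b i) {:F} = #|jump_group vF pi h b i|.
Proof. by rewrite (dim_fixedField (J i)). Qed.

Lemma towerS i : (1 <= i <= h)%N ->
  (tower vF pi h b i <= tower vF pi h b i.+1)%VS.
Proof.
move=> /andP[i1 ih]; apply: fixedFieldS; rewrite /jump_group ih.
by case: ifP => iS; [rewrite lower_ramS ?jumpS ?leqnSn | rewrite sub1G].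
Qed.

Lemma index_lower_ram i : galois 1 {:F} -> (1 <= i <= h)%N ->
  #|lower_ram vF pi 0 : lower_ram vF pi (b i)|%g = \dim (tower vF pi h b i).
Proof.
move=> galF /andP[i1 ih].
have sub : lower_ram vF pi (b i) \subset lower_ram vF pi 0.
  by rewrite lower_ramS // ltW // jump_gt0 // i1.
have cardG : #|lower_ram vF pi 0| = \dim {:F}.
  by rewrite lower_ram0 -galois_dim // dimv1 divn1.
apply/eqP; rewrite -(eqn_pmul2l (cardG_gt0 (lower_ram_group (b i)))).
rewrite (@Lagrange _ (lower_ram_group 0) (lower_ram_group (b i)) sub) cardG.
rewrite [X in X == _](dim_sup_field (subvf (tower vF pi h b i))) dim_over_tower.
by rewrite /jump_group ih.
Qed.

(** * The Herbrand function at the jumps *)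

Lemma herbrandE (R : realType) N : herbrand vF pi (N%:R : R) =
  \sum_(0 <= k < N) (#|lower_ram vF pi 0 : lower_ram vF pi k.+1%:Z|%g%:R)^-1.
Proof.
rewrite /herbrand ler0n.
apply: (Rintegral_ceil N
  (c := fun k => (#|lower_ram vF pi 0 : lower_ram vF pi k|%g%:R)^-1)).
by move=> k; rewrite invr_ge0 ler0n.
Qed.

Lemma herbrand_jump1 (R : realType) : (1 <= h)%N ->
  herbrand vF pi ((b 1)%:~R : R) = (b 1)%:~R.
Proof.
move=> h1; have b1 : b 1 = `|b 1|%N%:Z by rewrite gtz0_abs // jump_gt0 // h1.
rewrite {1}b1 [LHS]herbrandE big_nat (eq_bigr (fun=> 1)) => [|k /andP[_ kb]].
  by rewrite -big_nat sumr_const_nat subn0 {2}b1.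
rewrite (lower_ram_step (i := 1) (j := k.+1%:Z)) ?h1 //; [|lia|by case].
by rewrite lower_ram_jump1 // indexgg invr1.
Qed.

(** For [k] above the previous jump and up to [b i], the group [G_k] is that at [b i], of index
    [[F_i : K]], so all added summands are equal. *)
Lemma herbrand_jumpS (R : realType) i : galois 1 {:F} -> (1 < i <= h)%N ->
  herbrand vF pi ((b i)%:~R : R) =
    herbrand vF pi ((b i.-1)%:~R : R) +
      (b i - b i.-1)%:~R / (\dim (tower vF pi h b i))%:R.
Proof.
move=> galF; case: i => // i /andP[]; rewrite ltnS /= => i1 iSh.
have ih := ltnW iSh.
have bi : b i = `|b i|%N%:Z by rewrite gtz0_abs // jump_gt0 // i1.
have biS : b i.+1 = `|b i.+1|%N%:Z by rewrite gtz0_abs // jump_gt0 // iSh.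
have b_lt : b i < b i.+1 by apply: b_jumps.1.
rewrite bi biS [LHS]herbrandE [X in _ = X + _]herbrandE.
rewrite (big_cat_nat (n := `|b i|%N)) //=; last by lia.
congr (_ + _); rewrite big_nat (eq_bigr (fun=> (\dim (tower vF pi h b i.+1))%:R^-1)).
  rewrite -big_nat sumr_const_nat -[LHS]mulr_natl; congr (_ * _).
  by rewrite subzn //; lia.
move=> k /andP[bk kb]; rewrite -index_lower_ram //.
rewrite (lower_ram_step (i := i.+1) (j := k.+1%:Z)) ?iSh //; first by lia.
move=> l /andP[l1 li]; have := jumpS l1 (k := i); rewrite -ltnS li ih => /(_ isT); lia.
Qed.

(** The value at [b 1] is automatically an integer, so integrality at all jumps amounts to
    integrality of all increments. *)
Lemma hasse_arfP (R : realType) : galois 1 {:F} ->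
  hasse_arf vF pi R <-> forall i, (1 < i <= h)%N ->
    ((\dim (tower vF pi h b i))%:Z %| b i - b i.-1)%Z.
Proof.
move=> galF; split=> [HA i i_h|dvd_b j /b_jumps.2[i i_h ->{j}]].
  have isj k : (1 <= k <= h)%N -> herbrand vF pi ((b k)%:~R : R) \is a Num.int.
    by move=> k_h; apply/HA/b_jumps.2; exists k.
  rewrite -(intr_div_int R _ (adim_gt0 _)).
  have -> : (b i - b i.-1)%:~R / (\dim (tower vF pi h b i))%:R =
      herbrand vF pi ((b i)%:~R : R) - herbrand vF pi ((b i.-1)%:~R : R).
    by rewrite (herbrand_jumpS R galF i_h) [RHS]addrC addKr.
  by rewrite rpredB ?isj //; lia.
elim: i i_h => // -[_|i IHi] /andP[_ ih]; first by rewrite herbrand_jump1.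
rewrite (herbrand_jumpS R galF) // rpredD ?IHi ?(ltnW ih) //.
by rewrite intr_div_int ?adim_gt0 ?dvd_b.
Qed.

End Jumps.

End TotallyRamified.

Theorem theorem16 (R : realType) (p : nat)
  (K : fieldType) (vK : K -> \bar int)
  (vK_norm : normalized_valuation predT vK)
  (vK_complete : complete_valuation vK)
  (vK_res : residue_char vK p)
  (F : splittingFieldType K) (F_gal : galois 1%VS {:F}%VS)
  (vF : F -> \bar int)
  (vF_norm : normalized_valuation predT vF)
  (F_tot : totally_ramified vK vF)
  (pi : F) (pi_unif : vF pi = 1%:E)
  (F_wild : no_tame_part vF pi)
  (h : nat) (b : nat -> int)
  (b_jumps : lower_jumps vF pi h b)
  (b_prime : forall i : nat, (1 <= i <= h)%N -> coprimez (b i) p%:Z)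
  (v : nat -> F -> \bar int)
  (v_norm : forall i : nat, (1 <= i <= h.+1)%N ->
     normalized_valuation_below vF (tower vF pi h b i) (v i))
  (f : nat -> F)
  (f_in : forall i : nat, (1 <= i <= h)%N -> f i \in tower vF pi h b i.+1)
  (f_val : forall i : nat, (1 <= i <= h)%N -> v i.+1 (f i) = (- b i)%:E) :
  (hasse_arf vF pi R <->
   forall i : nat, (1 < i <= h)%N ->
     exists2 kappa : K, kappa != 0 &
       leading_form (v i.+1) (tower vF pi h b i) (tower vF pi h b i.+1)
         (f i) (f i.-1) kappa) /\
  (forall (i : nat) (kappa : K), (1 < i <= h)%N -> kappa != 0 ->
     leading_form (v i.+1) (tower vF pi h b i) (tower vF pi h b i.+1)
       (f i) (f i.-1) kappa ->
     (v i.+1 (f i) *+ \dim_(tower vF pi h b i) (tower vF pi h b i.+1))%E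
       = v i.+1 (kappa *: f i.-1)).
Proof.
have galP : (p.-group 'Gal({:F} / 1))%g.
  case: F_wild => G0 G01 _; apply: (gal_pgroup vK_norm vF_norm F_tot pi_unif vK_res).
  by rewrite -G01.
have towerS i : (1 <= i <= h)%N -> (tower vF pi h b i <= tower vF pi h b i.+1)%VS.
  exact: (towerS vK_norm vF_norm F_tot pi_unif b_jumps).
(* [[F_{i+1} : F_i]] divides the order of a [p]-group, hence is a power of [p], to which [b i] is
   prime. *)
have co_b i : (1 <= i <= h)%N ->
    coprime `|b i| (\dim_(tower vF pi h b i) (tower vF pi h b i.+1)).
  move=> i_h; have /p_natP[k ->] :
      p.-nat (\dim_(tower vF pi h b i) (tower vF pi h b i.+1)).
    apply: pnat_dvd galP; rewrite -galois_dim // dimv1 divn1.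
    apply: dvdn_trans (field_dimS (subvf (tower vF pi h b i.+1))).
    by rewrite [X in (_ %| X)%N](dim_sup_field (towerS i i_h)) dvdn_mulr.
  by apply: coprimeXr; have := b_prime i i_h; rewrite coprimezE.
(* Index shift: for [i > 1], the hypotheses on [f] at [i.-1] place [f i.-1] in the base field [F_i]
   of step [i]. *)
have step i : (1 < i <= h)%N -> [/\ (1 <= i.-1 <= h)%N, (1 <= i <= h)%N,
    f i.-1 \in tower vF pi h b i & v i (f i.-1) = (- b i.-1)%:E].
  case: i => // i /andP[]; rewrite ltnS /= => i1 ih.
  have i_h : (1 <= i <= h)%N by rewrite i1 ltnW.
  by split; rewrite ?f_in ?f_val.
have v_below i : (1 <= i <= h)%N ->
    normalized_valuation_below vF (tower vF pi h b i) (v i) /\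
    normalized_valuation_below vF (tower vF pi h b i.+1) (v i.+1).
  by case/andP=> i1 ih; split; apply: v_norm; lia.
split=> [|i kappa /step[_ i_h g_in g_val] _].
  rewrite (hasse_arfP vK_norm vF_norm F_tot pi_unif F_wild b_jumps R F_gal).
  have iff i : (1 < i <= h)%N -> (exists2 kappa : K, kappa != 0 &
       leading_form (v i.+1) (tower vF pi h b i) (tower vF pi h b i.+1)
         (f i) (f i.-1) kappa) <->
      ((\dim (tower vF pi h b i))%:Z %| b i - b i.-1)%Z.
    case/step => _ i_h g_in g_val; have [wP wP'] := v_below i i_h.
    exact: (leading_form_exists vK_norm vF_norm F_tot pi_unif (towerS i i_h)
      wP wP' (f_in i i_h) (f_val i i_h) g_in g_val (co_b i i_h)).
  by split=> H i i_h; apply/(iff i i_h)/H.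
have [wP wP'] := v_below i i_h.
exact: (leading_form_val vK_norm vF_norm F_tot pi_unif (towerS i i_h)
  wP wP' (f_in i i_h) (f_val i i_h) g_in (co_b i i_h)).
Qed.
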